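(* Let $\{S_N\}_{N\ge 1}$ be a monotonically non-decreasing sequence of positive integers. Then the following two assertions are equivalent: (i) The context predictability w.r.t. $\{S_N\}_{N\ge1}$ is universally achievable uniformly rapidly, that is, there exists a randomized sequential predictor producing random predictions $\hat{x}_t\in\{0,1\}$ of $x_t$ on the basis of $(x_1,\ldots,x_{t-1})$, $t=1,2,\ldots$, such that $$\limsup_{N\to\infty}\ \max_{x^N\in\{0,1\}^N}\left[\frac{1}{N}\sum_{t=1}^N \Pr\{\hat{x}_t\ne x_t\}-\kappa(x^N,S_N)\right]\le 0 ,$$ where the probabilities are w.r.t. the predictor's randomization and $\kappa(x^N,S)$ is the $S$-th order context predictability of $x^N$. (ii) $\lim_{N\to\infty} S_N/N=0$.
   Context: Notation. $x^N=(x_1,\ldots,x_N)\in\{0,1\}^N$ is a (deterministic, arbitrary) binary sequence. A complete binary tree is a finite rooted binary tree in which every node that is not a leaf has exactly two children, the two edges being labelled $0$ and $1$; the tree consisting of the root alone (which is then a leaf) is allowed. Randomized sequential predictor. For each $t\ge1$ and each $(x_1,\ldots,x_{t-1})\in\{0,1\}^{t-1}$, it specifies a probability distribution on $\{0,1\}$, according to which $\hat{x}_t$ is randomly drawn. The predictor is a single sequence of rules indexed by $t=1,2,\ldots$ (it need not be a context-tree predictor, has no restriction on its resources, and may depend on the given sequence $\{S_N\}$). $\Pr\{\hat{x}_t\ne x_t\}$ is the probability of error at time $t$ when the data sequence is $x_1,x_2,\ldots$. Context (suffix) tree. Let $T^C$ be a complete binary tree with $S^C\ge1$ leaves. Given $(x_1,\ldots,x_t)$,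 $t\ge0$, start at the root of $T^C$ and traverse the tree along edges labelled by the most recent symbols in reversed order (first $x_t$, then $x_{t-1}$, etc.), until a leaf is reached, or until $x_1$ has been read if this happens before a leaf is reached. If $k$ symbols have been read in this way, the context at that time is the string $(x_{t-k+1},\ldots,x_t)$ (the empty string if $k=0$). Prefix tree and transient states. Let $T^T$ be a complete binary tree with $S^T\ge0$ non-leaf nodes (the root, when it is not a leaf, is counted). Each non-leaf node of $T^T$ is called a transient state, and is identified with the binary string labelling the path from the root to it. The class $\mathcal{P}_S^*$. For a positive integer $S$, a member of $\mathcal{P}_S^*$ is specified by integers $S^T\ge 0$, $S^C\ge 1$ with $S^T+S^C\le S$, a prefix tree $T^T$ with $S^T$ non-leaf nodes, a context tree $T^C$ with $S^C$ leaves, and an output function $f$ assigning a value in $\{0,1\}$ to each transient state and to each context that can arise from $T^C$ (transient states and contexts are regarded as distinct states, even when they correspond to the same string). It operates as follows. For $t\ge0$, the state $\sigma_t$ after observing $(x_1,\ldots,x_t)$ is: - the transient state $(x_1,\ldots,x_t)$, if the string $(x_1,\ldots,x_t)$ is a non-leaf node of $T^T$ (in particular $\sigma_0$ is the root of $T^T$ if $S^T\ge1$); - otherwise (i.e., once a leaf of $T^T$ has been reached at time $t$ or earlier), the context determined by $T^C$ from $(x_1,\ldots,x_t)$, i.e., the string $(x_{t-k+1},\ldots,x_t)$, where $k$ is the number of symbols read when traversing $T^C$ from its root along the edges labelled $x_t,x_{t-1},\ldots$ until a leaf of $T^C$ is reached, or until $x_1$ has been read if this happens before a leaf is reached. The prediction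 of $x_{t+1}$ is $\hat{x}_{t+1}=f(\sigma_t)$, $t=0,1,2,\ldots$. Context predictability. The $S$-th order context predictability of $x^N$, denoted $\kappa(x^N,S)$, is the minimum, over all predictors in $\mathcal{P}_S^*$, of the fraction of errors $\frac1N|\{1\le t\le N:\hat{x}_t\ne x_t\}|$ made on $x^N$. (Allowing randomized output functions and taking the minimum expected fraction of errors gives the same value.) *)

(* Defs.v *)
From mathcomp Require Import all_boot all_order all_algebra.
From mathcomp Require Import all_classical all_reals all_analysis.

Set Implicit Arguments.
Unset Strict Implicit.
Unset Printing Implicit Defensive.

Import Order.TTheory GRing.Theory Num.Theory.
Import numFieldNormedType.Exports.

Local Open Scope classical_set_scope.
Local Open Scope ring_scope.

(* Symbols 0 and 1 are [false] and [true]. Strings and observed pasts are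
   written in chronological order, oldest symbol first: with [x : N.-tuple bool]
   (0-based), the past (x_1, ..., x_t) is [take t x] and x_{t+1} is [tnth x t]. *)

(* [Node l r] has children [l] along edge 0 and [r] along edge 1. *)
Inductive btree := Leaf | Node of btree & btree.

Definition child (l r : btree) (b : bool) : btree := if b then r else l.

Fixpoint leaves (T : btree) : nat :=
  if T is Node l r then (leaves l + leaves r)%N else 1%N.

Fixpoint inner_nodes (T : btree) : nat :=
  if T is Node l r then (inner_nodes l + inner_nodes r).+1 else 0%N.

(* The path labelled [s] from the root of [T] leads to a non-leaf node. *)
Fixpoint is_inner (T : btree) (s : seq bool) : bool :=
  match T, s with
  | Leaf, _ => false
  | Node _ _, [::] => true
  | Node l r, b :: s' => is_inner (child l r b) s'
  end.

(* Number of symbols of [s] read from the root of [T] until a leaf is reached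
   or [s] is exhausted. *)
Fixpoint read_length (T : btree) (s : seq bool) : nat :=
  match T, s with
  | Node l r, b :: s' => (read_length (child l r b) s').+1
  | _, _ => 0%N
  end.

Definition context (T : btree) (past : seq bool) : seq bool :=
  drop (size past - read_length T (rev past)) past.

(* The two constructors keep a transient state and a context apart even when
   they are the same string. *)
Inductive state := Transient of seq bool | Context of seq bool.

(* [output] is total; its values at states that never arise are irrelevant. *)
Record tree_predictor := TreePredictor {
  prefix_tree : btree;
  context_tree : btree;
  output : state -> bool }.

Definition state_after (P : tree_predictor) (past : seq bool) : state :=
  if is_inner (prefix_tree P) past then Transient past
  else Context (context (context_tree P) past).

Definition predict (P : tree_predictor) (past : seq bool) : bool :=
  output P (state_after P past).

Definition tree_class (S : nat) : set tree_predictor :=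
  [set P | (inner_nodes (prefix_tree P) + leaves (context_tree P) <= S)%N].

Definition errors (P : tree_predictor) (N : nat) (x : N.-tuple bool) : nat :=
  (\sum_(t < N) (predict P (take t x) != tnth x t))%N.

Definition error_fraction (R : realType) (N : nat) (x : N.-tuple bool)
    (P : tree_predictor) : R := (errors P x)%:R / N%:R.

(* The infimum is attained: see [context_predictability_min]. *)
Definition context_predictability (R : realType) (N : nat) (x : N.-tuple bool)
    (S : nat) : R := inf (error_fraction R x @` tree_class S).

Lemma context_predictability_min (R : realType) (N : nat) (x : N.-tuple bool)
    (S : nat) : (0 < S)%N ->
  exists2 P, tree_class S P &
    context_predictability R x S = error_fraction R x P /\
    forall Q, tree_class S Q -> error_fraction R x P <= error_fraction R x Q.
Proof.
move=> S0; pose p k := `[< exists2 P, tree_class S P & errors P x = k >].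
have ex_p : exists k, p k.
  pose P0 := TreePredictor Leaf Leaf (fun=> false).
  by exists (errors P0 x); apply/asboolP; exists P0.
case: (ex_minnP ex_p) => k /asboolP[P PS Pk] kmin.
have Pmin Q : tree_class S Q -> error_fraction R x P <= error_fraction R x Q.
  move=> QS; rewrite ler_wpM2r ?invr_ge0// ler_nat Pk kmin//.
  by apply/asboolP; exists Q.
exists P => //; split=> //; apply/eqP; rewrite eq_le; apply/andP; split.
  apply: ge_inf; last by exists P.
  by exists (error_fraction R x P) => _ [Q QS <-]; exact: Pmin.
apply: lb_le_inf; first by exists (error_fraction R x P), P.
by move=> _ [Q QS <-]; exact: Pmin.
Qed.

(* The distribution of the prediction given the past; the time index is one
   plus the length of the past. *)
Definition randomized_predictor (R : realType) := seq bool -> probability bool R.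

Definition error_probability (R : realType) (q : randomized_predictor R)
    (N : nat) (x : N.-tuple bool) (t : 'I_N) : R :=
  fine (q (take t x) [set b | b != tnth x t]).

Definition excess (R : realType) (S : nat -> nat) (q : randomized_predictor R)
    (N : nat) (x : N.-tuple bool) : R :=
  (\sum_(t < N) error_probability q x t) / N%:R
  - context_predictability R x (S N).

Local Open Scope ereal_scope.

Definition universally_achievable_uniformly_rapidly (R : realType)
    (S : nat -> nat) : Prop :=
  exists q : randomized_predictor R,
    limn_esup (fun N => \big[maxe/-oo]_(x : N.-tuple bool) (excess S q x)%:E)
    <= 0.

(* Main.v *)
Require Import Defs.
From mathcomp Require Import all_boot all_order all_algebra.
From mathcomp Require Import all_classical all_reals all_analysis.
From mathcomp Require Import ring lra zify.
Import Order.TTheory GRing.Theory Num.Theory.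
Import numFieldNormedType.Exports.
Local Open Scope classical_set_scope.
Local Open Scope ring_scope.

(* (i) => (ii): against any predictor choose each bit so that it is mispredicted
   with probability at least 1/2.  A prefix tree along the sequence with
   [S_N - 1] transient states makes no error on as many symbols, and one more
   context state loses at most half of the others; the excess is therefore at
   least about [S_N / 2N].

   (ii) => (i): a predictor with [S] states has a self-delimiting code of at most
   [4 S] bits, so exponential weights with prior [32^-(S+1)] and learning rate
   [eta] have regret [eta n + O(S / eta)] over [n] steps, for all [S] at once.
   Restart this algorithm at times [T j] with rate [1/(j+1)].  The regret up to
   [T j] is the sum of the rates plus [O(S j^2)]; the rates vanish in Cesaro mean,
   and the restarts can be made so rare that [S_N j^3 = O(N)] once [N >= T j]. *)

(** * Self-delimiting codes of tree predictors *)

Lemma leaves_inner_nodes (T : btree) : leaves T = (inner_nodes T).+1.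
Proof. by elim: T => //= l -> r ->; rewrite addnS. Qed.

Lemma is_inner_read_length (T : btree) (s : seq bool) :
  is_inner T s -> read_length T s = size s.
Proof.
by elim: T s => [|l IHl r IHr] [|[] s] //=; [move/IHr->|move/IHl->].
Qed.

(** This puts a reversed context among the nodes of the context tree, where [encode_inj] compares
    outputs; it is an inner node when the past runs out first. *)
Lemma read_length_take (T : btree) (s : seq bool) :
  read_length T (take (read_length T s) s) = size (take (read_length T s) s).
Proof. by elim: T s => [|l IHl r IHr] [|[] s] //=; rewrite ?IHl ?IHr. Qed.

(* Self-delimiting preorder code of a tree together with a bit [f p] at every
   node [p]. *)
Fixpoint encode (T : btree) (f : seq bool -> bool) : seq bool :=
  if T is Node l r then
    [:: true, f [::] & encode l (f \o cons false) ++ encode r (f \o cons true)]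
  else [:: false; f [::]].

Lemma size_encode (T : btree) (f : seq bool -> bool) :
  size (encode T f) = (2 * (leaves T + inner_nodes T))%N.
Proof.
by elim: T f => [|l IHl r IHr] f //=; rewrite size_cat IHl IHr; lia.
Qed.

(** The first bit tells a leaf from an inner node; the tails serve the induction, since the code of
    the right subtree belongs to the tail of the left one. The condition on [p] says that [p] is a
    node of [T]. *)
Lemma encode_inj (T T' : btree) (f f' : seq bool -> bool) (r r' : seq bool) :
  encode T f ++ r = encode T' f' ++ r' ->
  [/\ T = T', r = r' &
      forall p, read_length T p = size p -> f p = f' p].
Proof.
elim: T T' f f' r r' => [|tl IHl tr IHr] [|tl' tr'] f f' r r' //= [].
  by move=> ff' ->; split => // -[|].
move=> ff'; rewrite -!catA => /IHl[-> + fl] => /IHr[-> -> fr]; split=> //.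
by move=> [|[] p] //= [] => [/fr|/fl].
Qed.

Definition code (P : tree_predictor) : seq bool :=
  encode (prefix_tree P) (output P \o Transient) ++
  encode (context_tree P) (output P \o Context \o rev).

(** With [i] transient states and [c] context leaves the two codes take [4 * i + 2] and [4 * c - 2]
    bits. *)
Lemma size_code (P : tree_predictor) (S : nat) :
  tree_class S P -> (size (code P) <= 4 * S)%N.
Proof.
rewrite /tree_class/= size_cat !size_encode !leaves_inner_nodes; lia.
Qed.

Lemma predictE (P : tree_predictor) (s : seq bool) :
  predict P s = if is_inner (prefix_tree P) s then output P (Transient s) else
    output P (Context
      (rev (take (read_length (context_tree P) (rev s)) (rev s)))).
Proof.
by rewrite /predict /state_after take_rev revK; case: ifP.
Qed.

Lemma code_inj (P Q : tree_predictor) (r r' : seq bool) :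
  code P ++ r = code Q ++ r' -> predict P =1 predict Q.
Proof.
rewrite /code -!catA => /encode_inj[eT + fT] => /encode_inj[eC _ fC] s.
rewrite !predictE -eT -eC; case: ifP => [/is_inner_read_length/fT//|_].
exact/fC/read_length_take.
Qed.

(** Padding [r] is accepted so that words of length exactly [4 * S] name all predictors with at most
    [S] states. By [code_inj] the choice of [P] does not affect the result. *)
Definition decode (u : seq bool) : seq bool -> bool :=
  if pselect (exists P r, u = code P ++ r) is left uP
  then predict (projT1 (cid uP)) else fun=> false.

Lemma decode_surj (P : tree_predictor) (S : nat) : tree_class S P ->
  exists u : (4 * S).-tuple bool, decode u =1 predict P.
Proof.
move=> PS; pose s := code P ++ nseq (4 * S - size (code P)) false.
have szs : size s == (4 * S)%N.
  by rewrite size_cat size_nseq subnKC// size_code.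
exists (Tuple szs); rewrite /decode; case: pselect => [sP|[]].
  by case: cid => Q [r /= sQ] p; rewrite (@code_inj P Q _ _ sQ).
by exists P, (nseq (4 * S - size (code P)) false).
Qed.

(** * Mistake counts on time intervals *)

Definition mistakes (g : seq bool -> bool) (x : seq bool) (a b : nat) : nat :=
  (\sum_(a <= t < b) (g (take t x) != nth false x t))%N.

Lemma mistakes_take (g : seq bool -> bool) (x : seq bool) (a t : nat) :
  mistakes g (take t x) a t = mistakes g x a t.
Proof.
apply: eq_big_nat => i /andP[_ it].
by rewrite take_takel ?nth_take// ltnW.
Qed.

Lemma mistakes_cat (g : seq bool -> bool) (x : seq bool) (a b c : nat) :
  (a <= b)%N -> (b <= c)%N ->
  mistakes g x a c = (mistakes g x a b + mistakes g x b c)%N.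
Proof. by move=> ab bc; rewrite /mistakes (big_cat_nat ab bc). Qed.

Lemma mistakes_le (g : seq bool -> bool) (x : seq bool) (a b : nat) :
  (mistakes g x a b <= b - a)%N.
Proof.
rewrite -[leqRHS]muln1 -sum_nat_const_nat; apply: leq_sum => i _.
exact: leq_b1.
Qed.

(** * Regret of exponential weights over finitely many experts *)

Section exponential_weights.
Context {R : realType} {I : finType}.
Variables (w : I -> R) (g : I -> seq bool -> bool) (eta : R) (a : nat).
Hypothesis w_gt0 : forall i, 0 < w i.
Hypothesis eta_gt0 : 0 < eta.

Definition weight (s : seq bool) (i : I) : R :=
  w i * (1 + eta) ^- mistakes (g i) s a (size s).

Definition vote (s : seq bool) (b : bool) : R :=
  (\sum_(i | g i s == b) weight s i) / \sum_i weight s i.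

Let eta1_gt0 : 0 < 1 + eta. Proof. exact: addr_gt0. Qed.

Lemma weight_gt0 (s : seq bool) (i : I) : 0 < weight s i.
Proof. by rewrite mulr_gt0// invr_gt0 exprn_gt0. Qed.

Lemma vote_ge0 (s : seq bool) (b : bool) : 0 <= vote s b.
Proof. by rewrite divr_ge0// sumr_ge0// => i _; exact/ltW/weight_gt0. Qed.

Lemma sum_weight_gt0 (i : I) (s : seq bool) : 0 < \sum_i weight s i.
Proof.
rewrite (bigD1 i)//= ltr_wpDr ?weight_gt0//.
by apply: sumr_ge0 => j _; exact/ltW/weight_gt0.
Qed.

Lemma voteC (i : I) (s : seq bool) (b : bool) : vote s (~~ b) = 1 - vote s b.
Proof.
have W0 := sum_weight_gt0 i s.
apply/eqP; rewrite -(subr_eq0) opprB addrA subr_eq0 /vote -mulrDl; apply/eqP.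
rewrite -[RHS](@divff _ (\sum_i weight s i)) ?gt_eqF//; congr (_ / _).
rewrite [RHS](bigID (fun i => g i s == b))/= addrC; congr (_ + _).
by apply: eq_bigl => j; case: (g j s); case: b.
Qed.

(** A wrong expert loses the fraction [eta / (1 + eta)] of its weight, which is a division by
    [1 + eta]. *)
Lemma weight_step (x : seq bool) (n : nat) (i : I) :
  (a <= n < size x)%N ->
  weight (take n.+1 x) i = weight (take n x) i -
    (if g i (take n x) == ~~ nth false x n
     then eta / (1 + eta) * weight (take n x) i else 0).
Proof.
move=> /andP[an nx]; rewrite /weight !size_takel ?(ltnW nx)// !mistakes_take.
rewrite {1}/mistakes big_nat_recr//= -/(mistakes (g i) x a n).
have -> : (g i (take n x) == ~~ nth false x n) =
          (g i (take n x) != nth false x n).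
  by case: (g i _); case: nth.
case: (_ != _); last by rewrite addn0 subr0.
rewrite addn1 exprSr invfM; set u := _ ^- _; field.
by rewrite gt_eqF.
Qed.

Lemma sum_weight_step (x : seq bool) (n : nat) (i : I) :
  (a <= n < size x)%N ->
  \sum_i weight (take n.+1 x) i = (\sum_i weight (take n x) i) *
    (1 - eta / (1 + eta) * vote (take n x) (~~ nth false x n)).
Proof.
move=> anx; under eq_bigr do rewrite weight_step//.
rewrite sumrB -big_mkcond/= -mulr_sumr /vote mulrBr mulr1; congr (_ - _).
have W0 := sum_weight_gt0 i (take n x).
rewrite mulrCA [X in _ = _ * X]mulrCA mulfV ?mulr1// gt_eqF//.
Qed.

Lemma sum_weight_le (x : seq bool) (n : nat) (i : I) : (a <= n <= size x)%N ->
  \sum_i weight (take n x) i <= (\sum_i w i) * expR (- (eta / (1 + eta) *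
    \sum_(a <= t < n) vote (take t x) (~~ nth false x t))).
Proof.
move=> /andP[]; elim: n => [|n IH] an nx.
  rewrite big_geq// mulr0 oppr0 expR0 mulr1; apply: ler_sum => j _.
  by rewrite /weight take0 /= /mistakes big_geq// expr0 invr1 mulr1.
have [an'|na] := leqP a n; last first.
  have -> : a = n.+1 by apply/eqP; rewrite eqn_leq an.
  rewrite big_geq// mulr0 oppr0 expR0 mulr1; apply: ler_sum => j _.
  rewrite /weight size_takel// mistakes_take /mistakes.
  by rewrite big_geq// expr0 invr1 mulr1.
rewrite sum_weight_step// ?an'// big_nat_recr//= [in leRHS]mulrDr opprD expRD mulrA.
have W0 := sum_weight_gt0 i (take n x).
(* Here [1 - y <= expR (- y)] bounds the shrinking factor of the total weight. *)
apply: (le_trans (y := (\sum_i weight (take n x) i) *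
   expR (- (eta / (1 + eta) * vote (take n x) (~~ nth false x n))))).
  by rewrite ler_pM2l// expR_ge1Dx.
by rewrite ler_pM2r ?expR_gt0// IH// ltnW.
Qed.

(** An expert with [L] mistakes keeps weight at least [expR (- K - eta * L)], because
    [1 + eta <= expR eta], and this is at most the total weight. Taking logarithms,
    [V <= (1 + eta) * L + (1 + eta) / eta * K]; conclude with [L <= n - a] and [eta <= 1]. *)
Lemma exponential_weights_regret (x : seq bool) (n : nat) (i : I) (K : R) :
  eta <= 1 -> (a <= n <= size x)%N -> \sum_i w i <= 1 -> expR (- K) <= w i ->
  \sum_(a <= t < n) vote (take t x) (~~ nth false x t) <=
  (mistakes (g i) x a n)%:R + eta * (n - a)%:R + 2 / eta * K.
Proof.
move=> eta1 /[dup] anx /andP[an nx] w1 Kw.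
set V := \sum_(a <= t < n) _.
set L := mistakes (g i) x a n.
have : expR (- K) * expR (- (eta * L%:R)) <= expR (- (eta / (1 + eta) * V)).
  apply: (@le_trans _ _ (weight (take n x) i)).
    rewrite /weight size_takel// mistakes_take -/L.
    apply: ler_pM; rewrite ?expR_ge0// expRN lef_pV2 ?posrE ?expR_gt0 ?exprn_gt0//.
    by rewrite expRM_natr lerXn2r ?nnegrE ?expR_ge0 ?(ltW eta1_gt0) ?expR_ge1Dx.
  apply: (@le_trans _ _ (\sum_i weight (take n x) i)).
    rewrite (bigD1 i)//= lerDl sumr_ge0// => j _; exact/ltW/weight_gt0.
  apply: (le_trans (sum_weight_le _ _ i anx)).
  by rewrite ler_piMl// expR_ge0.
rewrite -expRD ler_expR -opprD lerN2 -ler_pdivlMl ?divr_gt0// => VL.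
apply: (le_trans VL).
have LN : L%:R <= (n - a)%:R :> R by rewrite ler_nat mistakes_le.
have -> : (eta / (1 + eta))^-1 * (K + eta * L%:R) =
   L%:R + eta * L%:R + (1 + eta) / eta * K.
  field; by rewrite !gt_eqF.
have K0 : 0 <= K.
  rewrite -oppr_le0 -ler_expR expR0; apply: (le_trans Kw).
  apply: le_trans w1; rewrite (bigD1 i)//= lerDl sumr_ge0// => j _; exact: ltW.
rewrite lerD// ?lerD2l ?ler_pM2l// ler_wpM2r// ler_pM2r ?invr_gt0//.
by lra.
Qed.

End exponential_weights.

(** * The mixture of tree predictors *)

Local Notation expert_index n := {k : 'I_n.+1 & (4 * k).-tuple bool}.

Definition expert (n : nat) (i : expert_index n) : seq bool -> bool :=
  decode (tagged i).

Definition prior {R : realType} (n : nat) (i : expert_index n) : R :=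
  32 ^- (tag i).+1.

(** The [2 ^ (4 * k)] words of length [4 * k] have total mass [2 ^ (- k) / 32]. *)
Lemma sum_prior_le1 (R : realType) (n : nat) :
  \sum_(i : expert_index n) prior n i <= 1 :> R.
Proof.
have H m : \sum_(k < m) (2 ^+ (4 * k)) * 32 ^- k.+1 <= 1 - 2 ^- m :> R.
  elim: m => [|m IH]; first by rewrite big_ord0 expr0 invr1 subrr.
  rewrite big_ord_recr/=; apply: (le_trans (lerD IH (lexx _))).
  have -> : 2 ^+ (4 * m) * 32 ^- m.+1 = 2 ^- m / 32 :> R.
    rewrite exprM [32 ^+ _]exprSr invfM mulrA -expr_div_n; congr (_ / _).
    by rewrite -exprVn; congr (_ ^+ _); field.
  have : 0 < 2 ^- m :> R by rewrite invr_gt0 exprn_gt0.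
  by rewrite [2 ^+ m.+1]exprSr invfM; lra.
rewrite -(@sig_big_dep _ _ _ 'I_n.+1 (fun k => (4 * k).-tuple bool) xpredT
  (fun _ => xpredT) (fun k _ => 32 ^- k.+1))/=.
apply: (@le_trans _ _ (1 - 2 ^- n.+1)); last first.
  by rewrite gerBl invr_ge0 exprn_ge0.
apply: le_trans (H n.+1); apply: ler_sum => k _.
by rewrite sumr_const card_tuple card_bool -[leLHS]mulr_natl natrX.
Qed.

Definition tree_vote {R : realType} (n : nat) (eta : R) (a : nat) :=
  vote (prior n) (expert n) eta a.

Lemma tree_voteC (R : realType) (n : nat) (eta : R) (a : nat) (s : seq bool)
  (b : bool) : 0 < eta -> tree_vote n eta a s (~~ b) = 1 - tree_vote n eta a s b.
Proof.
move=> eta0; apply: voteC => //; first by move=> i; rewrite invr_gt0 exprn_gt0.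
by exists ord0; exact: [tuple of nseq _ false].
Qed.

Lemma tree_vote01 (R : realType) (n : nat) (eta : R) (a : nat) (s : seq bool)
  (b : bool) : 0 < eta -> 0 <= tree_vote n eta a s b <= 1.
Proof.
move=> eta0.
have vote0 c : 0 <= tree_vote n eta a s c.
  by apply: vote_ge0 => // i; rewrite invr_gt0 exprn_gt0.
by rewrite vote0 -subr_ge0 -tree_voteC ?vote0.
Qed.

(* Epochs end before [n], so predictors with more than [n] states need not be
   experts: for them the bound exceeds the number of steps. *)
Lemma tree_vote_regret (R : realType) (n : nat) (eta : R) (a b S : nat)
    (P : tree_predictor) (x : seq bool) :
  0 < eta <= 1 -> tree_class S P -> (a <= b <= size x)%N -> (b <= n)%N ->
  \sum_(a <= t < b) tree_vote n eta a (take t x) (~~ nth false x t) <=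
  (mistakes (predict P) x a b)%:R + eta * (b - a)%:R + 128 / eta * S%:R.
Proof.
move=> /andP[eta0 eta1] PS abx bn; have [Sn|nS] := ltnP S n.+1; last first.
  apply: (@le_trans _ _ (128 / eta * S%:R)); last first.
    by rewrite lerDr addr_ge0// mulr_ge0// ltW.
  apply: (@le_trans _ _ S%:R); last first.
    by rewrite ler_peMl// ler_pdivlMr// mul1r (le_trans eta1)// ler1n.
  apply: (@le_trans _ _ (\sum_(a <= t < b) 1)).
    by apply: ler_sum => t _; case/andP: (tree_vote01 R n eta a (take t x)
      (~~ nth false x t) eta0).
  rewrite sumr_const_nat ler_nat; lia.
have [u uP] := decode_surj P S PS.
pose i : expert_index n := Tagged (fun k : 'I_n.+1 => (4 * k).-tuple bool)
  (u : (4 * Ordinal Sn).-tuple bool).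
have -> : mistakes (predict P) x a b = mistakes (expert n i) x a b.
  by apply: eq_bigr => t _; rewrite -uP.
have S0 : (0 < S)%N.
  by move: PS; rewrite /tree_class/= leaves_inner_nodes; lia.
(* The prior is at least [expR (- K)] for [K = 64 * S], since [32 <= expR 32] and
   [32 * (S + 1) <= 64 * S]. *)
have -> : 128 / eta * S%:R = 2 / eta * (64 * S%:R).
  by field; rewrite gt_eqF.
apply: (@exponential_weights_regret R (expert_index n)) => //.
- by move=> j; rewrite invr_gt0 exprn_gt0.
- exact: sum_prior_le1.
- rewrite expRN /prior lef_pV2 ?posrE ?expR_gt0 ?exprn_gt0//=.
  apply: (@le_trans _ _ (expR 32 ^+ S.+1)).
    rewrite lerXn2r ?nnegrE ?expR_ge0//; apply: le_trans (expR_ge1Dx _).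
    by rewrite lerDr.
  rewrite -expRM_natl ler_expR -[S.+1]addn1 natrD.
  have : 1 <= S%:R :> R by rewrite ler1n.
  lra.
Qed.

(** * Uniform achievability in epsilon form *)

Lemma limn_esup_le0P (R : realType) (u : nat -> \bar R) :
  (limn_esup u <= 0)%E <->
  forall e : R, 0 < e -> \forall N \near \oo, (u N <= e%:E)%E.
Proof.
split=> [u0 e e0|ue]; last first.
  apply/lee_addgt0Pr => e e0; rewrite add0e.
  apply: (@le_trans _ _ (ereal_sup (u @` [set N | (u N <= e%:E)%E]))).
    by apply: ereal_inf_lbound; exists [set N | (u N <= e%:E)%E] => //; exact: ue.
  by apply: ge_ereal_sup => _ [N /= ? <-].
have : (limn_esup u < e%:E)%E by rewrite (le_lt_trans u0)// lte_fin.
move=> /ereal_inf_lt[_ [V V_oo <-]] /ltW Ve.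
apply: filterS V_oo => N VN; apply: le_trans Ve.
by apply: ereal_sup_ubound; exists N.
Qed.

Lemma universally_achievableP (R : realType) (S : nat -> nat) :
  universally_achievable_uniformly_rapidly R S <->
  exists q : randomized_predictor R, forall e : R, 0 < e ->
    \forall N \near \oo, forall x : N.-tuple bool, excess S q x <= e.
Proof.
have maxP q (e : R) N :
    (\big[maxe/-oo]_(x : N.-tuple bool) (excess S q x)%:E <= e%:E)%E <->
    forall x : N.-tuple bool, excess S q x <= e.
  split=> [/bigmax_leP[_ qe] x|qe]; first by rewrite -lee_fin qe.
  by apply/bigmax_leP; split=> [|x _]; rewrite ?leNye ?lee_fin.
split=> -[q qS]; exists q.
  move/limn_esup_le0P: qS => qS e /qS; apply: filterS => N; exact: (maxP q e N).1.
apply/limn_esup_le0P => e /qS; apply: filterS => N; exact: (maxP q e N).2.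
Qed.

(** * The restarting predictor and its excess *)

Lemma errors_mistakes (P : tree_predictor) (N : nat) (x : N.-tuple bool) :
  errors P x = mistakes (predict P) x 0 N.
Proof.
rewrite /errors /mistakes big_mkord; apply: eq_bigr => t _.
by rewrite (tnth_nth false).
Qed.

Lemma bernoulli_prob_neq (R : realType) (p : R) (c : bool) : 0 <= p <= 1 ->
  fine (bernoulli_prob p [set b | b != c]) = if c then 1 - p else p.
Proof.
move=> p01; rewrite bernoulli_probE// !diracE.
case: c => /=.
  rewrite memNset/=; last by move=> /= /negP.
  by rewrite mem_set//= mulr0 add0r mulr1.
rewrite mem_set//= memNset/=; last by move=> /= /negP.
by rewrite mulr0 addr0 mulr1.
Qed.

Section restarting_predictor.
Context {R : realType}.
Variables (T J : nat -> nat).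
Hypothesis T0 : T 0 = 0%N.
Hypothesis T_mono : {homo T : i j / (i <= j)%N}.
Hypothesis J_epoch : forall t, (T (J t) <= t < T (J t).+1)%N.

Definition rate (t : nat) : R := (J t).+1%:R^-1.

(** A restart resets only the weights; the experts still see the whole past. The cap on the number
    of states is the end of the epoch, as [tree_vote_regret] requires. *)
Definition restarting_vote (s : seq bool) : bool -> R :=
  tree_vote (T (J (size s)).+1) (rate (size s)) (T (J (size s))) s.

Definition restarting_predictor : randomized_predictor R :=
  fun s => bernoulli_prob (restarting_vote s true).

Lemma epoch_unique (j t : nat) : (T j <= t < T j.+1)%N -> J t = j.
Proof.
move=> /andP[jt tj]; have /andP[Jt tJ] := J_epoch t.
apply/eqP; rewrite eqn_leq; apply/andP; split; rewrite leqNgt; apply/negP => H.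
  by have := T_mono _ _ H; lia.
by have := T_mono _ _ H; lia.
Qed.

Lemma rate_gt0 (t : nat) : 0 < rate t. Proof. by rewrite invr_gt0. Qed.

Lemma error_probability_restarting (N : nat) (x : N.-tuple bool) (t : 'I_N) :
  error_probability restarting_predictor x t =
  restarting_vote (take t x) (~~ nth false x t).
Proof.
rewrite /error_probability bernoulli_prob_neq; last first.
  exact/tree_vote01/rate_gt0.
rewrite (tnth_nth false); case: nth => //=.
by rewrite /restarting_vote -tree_voteC ?rate_gt0.
Qed.

(** Induction on the epochs: epoch [i < j] costs at most its rates plus [128 * (i + 1) * S]. *)
Lemma restarting_regret (S j N : nat) (P : tree_predictor) (x : seq bool) :
  tree_class S P -> (N <= T j)%N -> (N <= size x)%N ->
  \sum_(0 <= t < N) restarting_vote (take t x) (~~ nth false x t) <=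
  (mistakes (predict P) x 0 N)%:R + \sum_(0 <= t < N) rate t +
  128 * j%:R ^+ 2 * S%:R.
Proof.
move=> PS; elim: j N => [|j IH] N NT Nx.
  move: NT; rewrite T0 leqn0 => /eqP->.
  by rewrite !big_geq// /mistakes big_geq// expr0n/= mulr0 mul0r !addr0.
have [NTj|TjN] := leqP N (T j).
  apply: (le_trans (IH N NTj Nx)); rewrite lerD2l ler_wpM2r// ler_pM2l//.
  by rewrite lerXn2r ?nnegrE// ler_nat.
have J_j t : (T j <= t < N)%N -> J t = j.
  by move=> /andP[jt tN]; apply: epoch_unique; rewrite jt (leq_trans tN).
rewrite (big_cat_nat (n := T j))//=; last exact: ltnW.
rewrite [\sum_(0 <= t < N) rate t](big_cat_nat (n := T j))//=; last exact: ltnW.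
rewrite (@mistakes_cat _ _ 0 (T j))//; last exact: ltnW.
have := IH (T j) (leqnn _) (leq_trans (ltnW TjN) Nx).
have -> : \sum_(T j <= t < N) restarting_vote (take t x) (~~ nth false x t) =
    \sum_(T j <= t < N) tree_vote (T j.+1) j.+1%:R^-1 (T j) (take t x)
      (~~ nth false x t).
  apply: eq_big_nat => t /[dup] tj /andP[_ tN].
  by rewrite /restarting_vote /rate size_takel ?J_j// ltnW// (leq_trans tN).
have -> : \sum_(T j <= t < N) rate t = j.+1%:R^-1 * (N - T j)%:R.
  rewrite mulr_natr -sumr_const_nat; apply: eq_big_nat => t /J_j tj.
  by rewrite /rate tj.
have := @tree_vote_regret R (T j.+1) j.+1%:R^-1 (T j) N S P x.
rewrite invr_gt0 ltr0n invf_le1// ler1n (ltnW TjN) Nx => /(_ isT PS isT NT).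
rewrite invrK natrD.
(* The epoch costs add up because [j ^ 2 + (j + 1) + j = (j + 1) ^ 2]. *)
have : 0 <= j%:R * S%:R :> R by rewrite mulr_ge0.
rewrite -(natr1 j).
set m1 := _%:R; set m2 := _%:R; set s1 := \sum_(_ <= _ < _) _.
set s2 := \sum_(_ <= _ < _) _; set s3 := \sum_(_ <= _ < _) _.
nra.
Qed.

Lemma excess_restarting (S : nat -> nat) (N : nat) (x : N.-tuple bool) :
  (0 < S N)%N -> excess S restarting_predictor x <=
  (\sum_(0 <= t < N) rate t + 128 * (J N).+1%:R ^+ 2 * (S N)%:R) / N%:R.
Proof.
move=> SN; rewrite /excess; have [P PS [-> _]] := context_predictability_min R x SN.
rewrite /error_fraction -mulrBl ler_wpM2r ?invr_ge0//.
rewrite errors_mistakes lerBlDl addrA.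
under eq_bigr do rewrite error_probability_restarting.
rewrite -(big_mkord xpredT
  (fun t => restarting_vote (take t x) (~~ nth false x t))).
apply: restarting_regret => //; last by rewrite size_tuple.
by case/andP: (J_epoch N) => _ /ltnW.
Qed.

Lemma cvg_rate : rate @ \oo --> (0 : R).
Proof.
apply/cvgrPdist_lt => e e0.
have [k _ /(_ k (leqnn k)) ke] := near_infty_natSinv_lt (PosNum e0).
exists (T k) => // t /= kt; rewrite sub0r normrN gtr0_norm ?rate_gt0//.
apply: le_lt_trans ke; rewrite /rate lef_pV2 ?posrE// ler_nat ltnS leqNgt.
apply/negP => Jk; have /andP[_] := J_epoch t.
by rewrite ltnNge (leq_trans _ kt)// T_mono.
Qed.

End restarting_predictor.

(** * Choice of the restart times *)

(** The cube has one factor more than the restart cost: if [J N = i.+1], then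
    [128 * (J N).+1 ^ 2 * S N / N] is at most [1 / (J N).+1], the rate at time [N]. *)
Lemma restart_schedule (R : realType) (S : nat -> nat) :
  ((fun N => (S N)%:R / N%:R : R) @ \oo --> (0 : R)) ->
  exists T J : nat -> nat,
    [/\ T 0 = 0, {homo T : i j / (i <= j)%N},
        forall t, (T (J t) <= t < T (J t).+1)%N &
        forall i N, (T i.+1 <= N)%N -> (128 * i.+2 ^ 3 * S N <= N)%N].
Proof.
move=> S0.
have /choice[M MS] : forall i, exists m, forall N, (m <= N)%N ->
    (128 * i.+2 ^ 3 * S N <= N)%N.
  move=> i; pose c : R := (128 * i.+2 ^ 3)%:R.
  have c0 : 0 < c by rewrite ltr0n muln_gt0 expn_gt0.
  move/cvgrPdist_lt : S0 => /(_ c^-1); rewrite invr_gt0 => /(_ c0)[m _ mS].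
  exists m.+1 => N mN; have /= := mS N (ltnW mN).
  have N0 : 0 < N%:R :> R by rewrite ltr0n (leq_trans _ mN).
  rewrite sub0r normrN ger0_norm ?divr_ge0// ltr_pdivrMr//.
  by rewrite ltr_pdivlMl// -natrM ltr_nat => /ltnW.
(* The summands make [T] strictly increasing and give [M i <= T i.+1]. *)
pose T j := (\sum_(i < j) (M i).+1)%N.
have TS j : T j.+1 = (T j + (M j).+1)%N by rewrite /T big_ord_recr.
have jT j : (j <= T j)%N by elim: j => // j IH; rewrite TS; lia.
have T_mono : {homo T : i j / (i <= j)%N}.
  by apply: homo_leq => // [j k l|j]; [exact: leq_trans|rewrite TS leq_addr].
have /choice[J JP] : forall t, exists j, (T j <= t < T j.+1)%N.
  move=> t; have ex_j : exists j, (t < T j.+1)%N by exists t; rewrite jT.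
  case: (ex_minnP ex_j) => -[|j] tj jmin; first by exists 0%N; rewrite {1}/T big_ord0.
  exists j.+1; rewrite tj andbT leqNgt; apply/negP => /jmin.
  by rewrite ltnn.
exists T, J; split => //; first by rewrite /T big_ord0.
by move=> i N; rewrite TS => iN; apply: MS; lia.
Qed.

(** * Sufficiency of [S N / N --> 0] *)

Lemma achievable_of_cvg (R : realType) (S : nat -> nat) :
  (forall N, (0 < N)%N -> (0 < S N)%N) ->
  ((fun N => (S N)%:R / N%:R : R) @ \oo --> (0 : R)) ->
  universally_achievable_uniformly_rapidly R S.
Proof.
move=> S_gt0 /restart_schedule[T [J [T0 T_mono J_epoch TS]]].
apply/universally_achievableP; exists (restarting_predictor T J) => e e0.
have e20 : 0 < e / 2 by rewrite divr_gt0.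
have rate0 := @cvg_rate R T J T_mono J_epoch.
have /cvgrPdist_lt/(_ _ e20)[n1 _ mean_e] := cesaro rate0.
have /cvgrPdist_lt/(_ _ e20)[n2 _ rate_e] := rate0.
(* The mean of the first [N] rates is [arithmetic_mean] at [N.-1], hence [n1.+1]; [T 1 <= N] makes
   [J N] positive, so that the schedule applies with [i = (J N).-1]. *)
exists (maxn n1.+1 (maxn n2 (T 1))) => // N /=.
rewrite !geq_max => /and3P[n1N n2N TN] x.
have N0 : (0 < N)%N by exact: leq_trans n1N.
apply: (le_trans (excess_restarting T J T0 T_mono J_epoch S N x (S_gt0 N N0))).
rewrite mulrDl [e]splitr lerD//.
  have := mean_e N.-1; rewrite /= -ltnS prednK// => /(_ n1N)/ltW.
  rewrite sub0r normrN; apply: le_trans; apply: le_trans (ler_norm _).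
  by rewrite /arithmetic_mean/= prednK// seriesEnat/= mulrC.
have := rate_e N n2N; rewrite /= sub0r normrN => /ltW; apply: le_trans.
apply: le_trans (ler_norm _).
have J0 : (0 < J N)%N.
  rewrite lt0n; apply/negP => /eqP JN.
  by have := J_epoch N; rewrite JN ltnNge TN andbF.
have := TS (J N).-1 N; rewrite !prednK//.
have /andP[-> _] := J_epoch N => /(_ isT).
rewrite -(ler_nat R) 2!natrM natrX => SN.
rewrite /rate ler_pdivrMr ?ltr0n// ler_pdivlMl//.
by apply: le_trans SN; rewrite le_eqVlt; apply/orP; left; apply/eqP; ring.
Qed.

(** * Memorizing predictors and an upper bound on the predictability *)

Fixpoint path_tree (s : seq bool) : btree :=
  if s is b :: s' then
    if b then Node Leaf (path_tree s') else Node (path_tree s') Leaf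
  else Leaf.

Lemma inner_nodes_path_tree (s : seq bool) : inner_nodes (path_tree s) = size s.
Proof. by elim: s => //= -[] s /= <-; rewrite ?addn0. Qed.

Lemma is_inner_path_tree (x : seq bool) (k t : nat) :
  (k <= size x)%N -> (t <= size x)%N ->
  is_inner (path_tree (take k x)) (take t x) = (t < k)%N.
Proof.
elim: x k t => [|b x IH] [|k] [|t]//=; rewrite ?ltn0//.
- by case: b.
- by rewrite !ltnS => kx tx; case: b => /=; rewrite -[RHS]IH.
Qed.

(** A transient state knows the time from its length and replays [x]; at most [k + 1] states are
    used. *)
Definition memorizer (x : seq bool) (k : nat) (c : bool) : tree_predictor :=
  TreePredictor (path_tree (take k x)) Leaf
    (fun s => if s is Transient p then nth false x (size p) else c).

Lemma mistakes_memorizer (x : seq bool) (k : nat) (c : bool) :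
  (k <= size x)%N ->
  mistakes (predict (memorizer x k c)) x 0 (size x) =
  (\sum_(k <= t < size x) (c != nth false x t))%N.
Proof.
move=> kx; rewrite (@mistakes_cat _ _ 0 k)//.
rewrite {1}/mistakes big_nat big1 ?add0n => [|t /andP[_ tk]].
  apply: eq_big_nat => t /andP[kt tx].
  by rewrite /predict /state_after/= is_inner_path_tree ?(ltnW tx)// ltnNge kt.
have tx := leq_trans tk kx.
rewrite /predict /state_after/= is_inner_path_tree ?(ltnW tx)// tk/=.
by rewrite size_takel ?eqxx// ltnW.
Qed.

(** The memorizers for [c = true] and [c = false] make [N - k] errors together, so one of them makes
    at most half. One state is the context, leaving [S.-1] transient ones. *)
Lemma predictability_le (R : realType) (N : nat) (x : N.-tuple bool)
    (S : nat) : (0 < S)%N ->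
  context_predictability R x S <= (N - minn S.-1 N)%:R / 2 / N%:R.
Proof.
move=> S0; set k := minn _ _.
have kx : (k <= size x)%N by rewrite size_tuple geq_minr.
have [P PS [-> Pmin]] := context_predictability_min R x S0.
have Pc c : (errors P x)%:R / N%:R <=
    (\sum_(k <= t < N) (c != nth false x t))%N%:R / N%:R :> R.
  apply: (le_trans (Pmin (memorizer x k c) _)).
    rewrite /tree_class/= inner_nodes_path_tree size_takel// addn1.
    by rewrite /k; lia.
  have := mistakes_memorizer x k c kx; rewrite size_tuple => <-.
  by rewrite /error_fraction errors_mistakes.
have <- : (\sum_(k <= t < N) (true != nth false x t) +
    \sum_(k <= t < N) (false != nth false x t) = N - k)%N.
  rewrite -big_split/= -[RHS]muln1 -sum_nat_const_nat.
  by apply: eq_bigr => t _; case: nth.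
rewrite natrD mulrAC mulrDl /error_fraction.
have := Pc true; have := Pc false; lra.
Qed.

(** * The adversarial sequence and a lower bound on the excess *)

(** The tested event is the error when the new bit is [true]. The strings for all [N] are prefixes
    of one infinite sequence. *)
Fixpoint adversary {R : realType} (q : randomized_predictor R) (N : nat) :=
  if N is N'.+1 then
    let s := adversary q N' in
    rcons s (2^-1 <= fine (q s [set b | b != true]))
  else [::].

Lemma size_adversary (R : realType) (q : randomized_predictor R) (N : nat) :
  size (adversary q N) == N.
Proof. by elim: N => //= N; rewrite size_rcons. Qed.

Lemma take_adversary (R : realType) (q : randomized_predictor R) (t N : nat) :
  (t <= N)%N -> take t (adversary q N) = adversary q t.
Proof.
move=> tN; rewrite -(subnK tN); elim: (N - t)%N => [|m IH].
  by rewrite add0n take_oversize// (eqP (size_adversary _ _ _)).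
by rewrite addSn /= -cats1 takel_cat// (eqP (size_adversary _ _ _)) leq_addl.
Qed.

Lemma error_probabilityC (R : realType) (q : randomized_predictor R)
    (s : seq bool) (c : bool) :
  fine (q s [set b | b != ~~ c]) = 1 - fine (q s [set b | b != c]).
Proof.
have -> : [set b | b != ~~ c] = ~` [set b | b != c].
  by apply/seteqP; split=> -[]; case: c => //= /(_ isT).
by rewrite probability_setC// fineB// fin_num_measure.
Qed.

Lemma adversary_error (R : realType) (q : randomized_predictor R) (N : nat)
    (x : N.-tuple bool) (t : 'I_N) :
  x = adversary q N :> seq bool -> 2^-1 <= error_probability q x t.
Proof.
move=> xE; have tE : nth false (adversary q N) t =
    (2^-1 <= fine (q (adversary q t) [set b | b != true])).
  rewrite -(@nth_take t.+1)// take_adversary// [adversary _ _]/=.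
  by rewrite nth_rcons (eqP (size_adversary _ _ _)) ltnn eqxx.
rewrite /error_probability (tnth_nth false) xE tE take_adversary; last exact: ltnW.
have [//|/ltW q2] := leP 2^-1 (fine (q (adversary q t) [set b | b != true])).
have := error_probabilityC R q (adversary q t) true; rewrite /= => ->; lra.
Qed.

Lemma excess_adversary (R : realType) (S : nat -> nat)
    (q : randomized_predictor R) (N : nat) (x : N.-tuple bool) :
  (0 < N)%N -> (0 < S N)%N -> x = adversary q N :> seq bool ->
  (minn (S N).-1 N)%:R / 2 / N%:R <= excess S q x.
Proof.
move=> N0 S0 xE; rewrite /excess.
have half : N%:R / 2 / N%:R <=
    (\sum_(t < N) error_probability q x t) / N%:R :> R.
  have -> : N%:R / 2 = \sum_(t < N) 2^-1 :> R.
    by rewrite sumr_const card_ord mulr_natl.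
  rewrite ler_wpM2r ?invr_ge0//; apply: ler_sum => t _.
  exact: adversary_error xE.
apply: le_trans (lerB half (predictability_le R _ _ _ S0)).
by rewrite -mulrBl ler_wpM2r ?invr_ge0// natrB ?geq_minr//; lra.
Qed.

(** * Necessity of [S N / N --> 0] *)

Lemma cvg_of_achievable (R : realType) (S : nat -> nat) :
  (forall N, (0 < N)%N -> (0 < S N)%N) ->
  universally_achievable_uniformly_rapidly R S ->
  ((fun N => (S N)%:R / N%:R : R) @ \oo --> (0 : R)).
Proof.
move=> S_gt0 /universally_achievableP[q qS]; apply/cvgrPdist_le => e e0.
(* For large [N], [(S N).-1 / 2 <= d * N] and [1 <= d * N], hence [S N <= 3 * d * N <= e * N]. The
   cap [1 / 4] excludes [(S N).-1 > N], where the excess would be at least [1 / 2]. *)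
pose d := Num.min (e / 4) (1 / 4).
have d0 : 0 < d by rewrite lt_min !divr_gt0.
have /andP[de d4] : (d <= e / 4) && (d <= 1 / 4).
  by rewrite !ge_min !lexx orbT.
have [n _ nS] := qS d d0.
have [m _ /(_ m (leqnn m)) me] := near_infty_natSinv_lt (PosNum d0).
exists (maxn n m.+1) => // N /=; rewrite geq_max => /andP[nN mN].
have N0 : (0 < N)%N by exact: leq_trans mN.
have NR : 0 < N%:R :> R by rewrite ltr0n.
have := le_trans (excess_adversary R S q N (Tuple (size_adversary R q N))
  N0 (S_gt0 N N0) erefl) (nS N nN _).
rewrite !ler_pdivrMr// => Sd.
have SN : ((S N).-1 <= N)%N.
  rewrite leqNgt; apply/negP => /ltnW/minn_idPr NS.
  by move: Sd; rewrite NS; nra.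
move: Sd; rewrite (minn_idPl SN) => Sd.
have Nd : 1 <= d * N%:R.
  rewrite -ler_pdivrMr// mul1r (le_trans _ (ltW me))// lef_pV2 ?posrE//.
  by rewrite ler_nat.
have SE : (S N)%:R = (S N).-1%:R + 1 :> R by rewrite natr1 prednK// S_gt0.
rewrite sub0r normrN ger0_norm ?divr_ge0// ler_pdivrMr// SE.
nra.
Qed.

Theorem theorem1 (R : realType) (S : nat -> nat)
    (S_gt0 : forall N : nat, (0 < N)%N -> (0 < S N)%N)
    (S_ndecr : forall M N : nat, (0 < M)%N -> (M <= N)%N -> (S M <= S N)%N) :
  universally_achievable_uniformly_rapidly R S <->
  ((fun N : nat => (S N)%:R / N%:R : R) @ \oo --> (0 : R)).
Proof.
split; first exact: cvg_of_achievable.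
exact: achievable_of_cvg.
Qed.
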